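(* Let $A\in\mathcal{B}(\mathcal{H})$ be a positive operator with $\dim(R(A))\ge 3$, let $T\in\mathcal{B}_{A^{1/2}}(\mathcal{H})$ and let $q\in\mathcal{D}$. Then $$W_{q,A}(T)=\bigcup\{\mathcal{G}(x): x\in\mathcal{H},\ \|x\|_A=1\},$$ where, for $x\in\mathcal{H}$ with $\|x\|_A=1$, $$\mathcal{G}(x)=\left\{a\in\mathbb{C}: |a-q\langle Tx,x\rangle_A|\le \alpha\sqrt{1-|q|^2}\right\},\qquad \alpha=\left(\|Tx\|_A^2-|\langle Tx,x\rangle_A|^2\right)^{1/2}.$$
   Context: $\mathcal{H}$ is a separable infinite-dimensional complex Hilbert space with inner product $\langle\cdot,\cdot\rangle$ (linear in the first variable); $\mathcal{B}(\mathcal{H})$ is the algebra of bounded linear operators on $\mathcal{H}$; $R(A)$ is the range of $A$. $A$ positive means $\langle Ax,x\rangle\ge 0$ for all $x$. Put $\langle x,y\rangle_A=\langle Ax,y\rangle$ and $\|x\|_A=\sqrt{\langle x,x\rangle_A}$. $\mathcal{D}=\{z\in\mathbb{C}:|z|\le 1\}$. $\mathcal{B}_{A^{1/2}}(\mathcal{H})=\{T\in\mathcal{B}(\mathcal{H}):\exists c>0,\ \|Tx\|_A\le c\|x\|_A\ \forall x\in\mathcal{H}\}$. The $A$-$q$-numerical range is $W_{q,A}(T)=\{\langle Tx,y\rangle_A: x,y\in\mathcal{H},\ \|x\|_A=\|y\|_A=1,\ \langle x,y\rangle_A=q\}$. *)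

(* Defs.v *)
From mathcomp Require Export all_boot all_order all_algebra.
From mathcomp Require Export complex.
From mathcomp Require Export all_classical all_reals all_analysis.
Export Order.TTheory GRing.Theory Num.Theory numFieldNormedType.Exports.
#[export] Set Implicit Arguments.
#[export] Unset Strict Implicit.
#[export] Unset Printing Implicit Defensive.

Global Open Scope classical_set_scope.
Global Open Scope ring_scope.

(* Conventions.
   - The complex field is R[i] for a realType R.  Its order is partial:
     z <= w means that w - z is a nonnegative real, so 0 <= z and 0 < z
     include the assertion that z is real.  Norms and moduli are R[i]-valued
     (with nonnegative real values), as in normedModType R[i].
   - An inner product is a {dot H for Num.conj}: positive definite, hermitian,
     linear in its first argument and conjugate-linear in the second. *)

Definition lin_indep (K : fieldType) (V : lmodType K) (n : nat)
    (v : 'I_n -> V) : Prop :=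
  forall c : 'I_n -> K, \sum_(i < n) c i *: v i = 0 -> forall i, c i = 0.

(* For a linear subspace S, this says that dim S >= n. *)
Definition dim_ge (K : fieldType) (V : lmodType K) (S : set V) (n : nat) : Prop :=
  exists v : 'I_n -> V, (forall i, S (v i)) /\ lin_indep v.

Definition infinite_dimensional (K : fieldType) (V : lmodType K) : Prop :=
  forall n : nat, dim_ge [set: V] n.

Definition separable_space (X : topologicalType) : Prop :=
  exists D : set X, countable D /\ dense D.

(* By linear_boundedP this is the existence of c with `|T x| <= c * `|x| for
   all x. *)
Definition bounded_operator (R : realType) (H : normedModType R[i])
    (T : {linear H -> H}) : Prop :=
  bounded_near T (nbhs (0 : H)).

Definition positive_operator (R : realType) (H : normedModType R[i])
    (dot : {dot H for Num.conj}) (A : {linear H -> H}) : Prop :=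
  forall x : H, 0 <= dot (A x) x.

Definition dotA (R : realType) (H : normedModType R[i])
    (dot : {dot H for Num.conj}) (A : {linear H -> H}) (x y : H) : R[i] :=
  dot (A x) y.

Definition normA (R : realType) (H : normedModType R[i])
    (dot : {dot H for Num.conj}) (A : {linear H -> H}) (x : H) : R[i] :=
  sqrtC (dotA dot A x x).

Definition A_bounded_operators (R : realType) (H : normedModType R[i])
    (dot : {dot H for Num.conj}) (A : {linear H -> H}) : set {linear H -> H} :=
  [set T | bounded_operator T /\
    exists2 c : R[i], 0 < c & forall x : H, normA dot A (T x) <= c * normA dot A x].

Definition q_numerical_range (R : realType) (H : normedModType R[i])
    (dot : {dot H for Num.conj}) (A : {linear H -> H}) (q : R[i])
    (T : {linear H -> H}) : set R[i] :=
  [set a | exists x y : H, [/\ normA dot A x = 1, normA dot A y = 1,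
     dotA dot A x y = q & a = dotA dot A (T x) y]].

Definition alpha (R : realType) (H : normedModType R[i])
    (dot : {dot H for Num.conj}) (A : {linear H -> H}) (T : {linear H -> H})
    (x : H) : R[i] :=
  sqrtC (normA dot A (T x) ^+ 2 - `|dotA dot A (T x) x| ^+ 2).

Definition disc_G (R : realType) (H : normedModType R[i])
    (dot : {dot H for Num.conj}) (A : {linear H -> H}) (q : R[i])
    (T : {linear H -> H}) (x : H) : set R[i] :=
  [set a | `|a - q * dotA dot A (T x) x| <=
           alpha dot A T x * sqrtC (1 - `|q| ^+ 2)].

(* Main.v *)
Require Import Defs.
From HB Require Import structures.
From mathcomp Require Import ring.

(** The form [B x y = <A x, y>] is a positive semidefinite hermitian form, and
    the identity is a statement about such a form.  Fix [x] with [B x x = 1],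
    write [t] for [T x] and split along [x]:
      [t = B t x *: x + w]   and   [y = q^* *: x + z],
    with [w] and [z] orthogonal to [x].  If [B x y = q] and [B y y = 1], then
      [B t y - q * B t x = B w z],
    where [B w w = B t t - |B t x|^2] is the square of [alpha], and
    [B z z = 1 - |q|^2].  The Cauchy-Schwarz inequality for [w] and [z] then
    puts [B t y] in the disc of [x] ([norm_sub_le]).

    Conversely, every complex number [b] with [|b|^2 <= B w w * (1 - |q|^2)] is
    some [B w z]: take the multiple of [w] that realises the value [b], and add
    a vector orthogonal to [x] and to [w] to bring [B z z] up to [1 - |q|^2]
    ([exists_unit_with_values]).  Here the rank hypothesis is used: among the
    combinations of three vectors with independent images under [A] there is a
    nonzero one that is orthogonal to both [x] and [t], and it has nonzero
    length because the isotropic vectors of [B] are those that [A] kills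
    ([exists_unit_orthogonal_of_rank]). *)

(** * Symmetry of positive sesquilinear forms *)

Section SesquilinearPolarization.
Variables (C : numClosedFieldType) (V : lmodType C).
Variable f : {bilinear V -> V -> C | *%R & (Num.conj \; *%R)}.

(** Only the values on the diagonal are known to be real; polarisation, which
    evaluates the form at [x + y] and at [x + 'i *: y], recovers the symmetry
    of the off-diagonal values from them. *)
Lemma psd_hermitian x y : (forall z, 0 <= f z z) -> f x y = (f y x)^*.
Proof.
move=> f_ge0.
have fC z : (f z z)^* = f z z by apply/CrealP/ger0_real.
have /eqP := fC (x + y).
rewrite linearDl !linearDr /= !rmorphD /= !fC => /eqP eq1.
have /eqP := fC (x + 'i *: y).
rewrite linearDl !linearDr /= !linearZl_LR !linearZr_LR /= !rmorphD !rmorphM /=.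
rewrite !fC !conjCi => /eqP; rewrite rmorphN /= conjCi => eq2.
have eq1' : (f x y)^* + (f y x)^* = f x y + f y x.
  apply: (addIr (f x x + f y y)).
  transitivity (f x x + (f x y)^* + ((f y x)^* + f y y)); first by ring.
  by rewrite eq1; ring.
have /(mulfI (neq0Ci C)) eq2' :
    'i * ((f x y)^* - (f y x)^*) = 'i * (f y x - f x y).
  apply: (addIr (f x x + 'i * - 'i * f y y)).
  set u := LHS; set v := RHS.
  transitivity (f x x + - - 'i * (f x y)^* +
                (- 'i * (f y x)^* + - - 'i * (- 'i * f y y))).
    by rewrite /u; ring.
  by rewrite eq2 /v -![_ *: _]/(_ * _); ring.
apply: (mulfI (_ : 2 != 0)); first by rewrite pnatr_eq0.
transitivity (f x y + f y x - (f y x - f x y)); first by ring.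
by rewrite -eq1' -eq2'; ring.
Qed.

End SesquilinearPolarization.

(** * Positive semidefinite hermitian forms *)

Section SemiInnerProduct.
Variables (C : numClosedFieldType) (V : lmodType C).
Variable B : {hermitian V for false & Num.conj}.
Local Notation "''[' u , v ]" := (B u v) : ring_scope.
Local Notation "''[' u ]" := '[u, u] : ring_scope.

Lemma hermitianC u v : '[u, v] = '[v, u]^*.
Proof. by rewrite [LHS]hermC mul1r. Qed.

Lemma sesquiDl u v w : '[u + v, w] = '[u, w] + '[v, w].
Proof. exact: linearDl. Qed.

Lemma sesquiDr u v w : '[u, v + w] = '[u, v] + '[u, w].
Proof. exact: linearDr. Qed.

Lemma sesquiBl u v w : '[u - v, w] = '[u, w] - '[v, w].
Proof. exact: linearBl. Qed.

Lemma sesquiBr u v w : '[u, v - w] = '[u, v] - '[u, w].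
Proof. exact: linearBr. Qed.

Lemma sesquiZl a u v : '[a *: u, v] = a * '[u, v].
Proof. exact: linearZl_LR. Qed.

Lemma sesquiZr a u v : '[u, a *: v] = a^* * '[u, v].
Proof. exact: linearZr_LR. Qed.

Lemma hermitianZ a u : '[a *: u] = `|a| ^+ 2 * '[u].
Proof. by rewrite sesquiZl sesquiZr /= normCK mulrA. Qed.

(** [u - '[u, x] *: x] is the part of [u] orthogonal to the unit vector [x], so
    the left-hand side, which compares ['[t, y]] with the value it would have if
    [t] or [y] were a multiple of [x], sees only these parts. *)
Lemma sesqui_sub_proj x t y : '[x] = 1 ->
  '[t, y] - '[x, y] * '[t, x] = '[t - '[t, x] *: x, y - '[y, x] *: x].
Proof.
move=> x1.
rewrite !(sesquiBl, sesquiBr) !(sesquiZl, sesquiZr) /= x1.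
by rewrite -(hermitianC x y); ring.
Qed.

Lemma norm_sub_proj x t : '[x] = 1 ->
  '[t - '[t, x] *: x] = '[t] - `|'[t, x]| ^+ 2.
Proof.
move=> x1; rewrite -sesqui_sub_proj// (hermitianC x t).
by rewrite normCK mulrC.
Qed.

Hypothesis B_ge0 : forall x, 0 <= '[x].

(** The form may have isotropic vectors, so [v] cannot always be normalised.
    In either case the squared length of [u - (k * '[u, v]) *: v] is
    nonnegative: when ['[v] != 0] the best [k] is its inverse; when ['[v] = 0]
    that square is affine in [k] and would become negative for large [k] unless
    ['[u, v] = 0]. *)
Lemma CauchySchwarz_semi u v : `|'[u, v]| ^+ 2 <= '[u] * '[v].
Proof.
have expand k : k \is Num.real ->
    '[u - (k * '[u, v]) *: v] =
    '[u] - 2 * k * `|'[u, v]| ^+ 2 + k ^+ 2 * `|'[u, v]| ^+ 2 * '[v].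
  move=> /CrealP kC.
  rewrite !(sesquiBl, sesquiBr) !(sesquiZl, sesquiZr) /= !rmorphM /= kC.
  by rewrite (hermitianC v u) !normCK; ring.
have [v0|v_neq0] := eqVneq '[v] 0; last first.
  have v_gt0 : 0 < '[v] by rewrite lt0r v_neq0 B_ge0.
  have := B_ge0 (u - ('[v]^-1 * '[u, v]) *: v).
  rewrite expand; last by rewrite realV ger0_real.
  rewrite -(pmulr_lge0 _ v_gt0).
  rewrite [X in 0 <= X](_ : _ = '[u] * '[v] - `|'[u, v]| ^+ 2) ?subr_ge0//.
  by field.
rewrite v0 mulr0; have [->//|uv_neq0] := eqVneq (`|'[u, v]| ^+ 2) 0.
(* This value of [k] makes the squared length equal to [-1]. *)
have k_real : ('[u] + 1) / (2 * `|'[u, v]| ^+ 2) \is Num.real.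
  by rewrite ger0_real// divr_ge0 ?addr_ge0 ?mulr_ge0 ?exprn_ge0.
have := B_ge0 (u - ('[u] + 1) / (2 * `|'[u, v]| ^+ 2) * '[u, v] *: v).
rewrite expand// v0 mulr0 addr0.
rewrite [X in 0 <= X](_ : _ = - 1) ?oppr_ge0 ?ler10//.
by field; move: uv_neq0; rewrite sqrf_eq0.
Qed.

Lemma isotropic_orthogonal u v : '[u] = 0 -> '[u, v] = 0.
Proof.
move=> u0; apply/eqP; rewrite -normr_eq0 -sqrf_eq0 eq_le exprn_ge0// andbT.
by rewrite (le_trans (CauchySchwarz_semi u v))// u0 mul0r.
Qed.

(** Orthogonality to the [m] vectors [x j] is a system of [m] homogeneous
    equations in the [n > m] coefficients of a combination of the [v i]; it has a
    nonzero solution, which can be normalised because the form is definite on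
    these combinations. *)
Lemma exists_unit_orthogonal m n (x : 'I_m -> V) (v : 'I_n -> V) :
  (m < n)%N ->
  (forall c : 'I_n -> C, '[\sum_i c i *: v i] = 0 -> forall i, c i = 0) ->
  exists2 u, '[u] = 1 & forall j, '[u, x j] = 0.
Proof.
move=> lt_mn v_def.
pose M := \matrix_(i < n, j < m) '[v i, x j].
have : kermx M != 0.
  rewrite -mxrank_eq0 mxrank_ker subn_eq0 -ltnNge.
  exact: leq_ltn_trans (rank_leq_col M) lt_mn.
move=> /rowV0Pn[c /sub_kermxP cM c_neq0].
pose u := \sum_i c 0 i *: v i.
have uu_gt0 : 0 < '[u].
  rewrite lt0r B_ge0 andbT; apply/eqP => uu0.
  move/eqP: c_neq0; apply; apply/rowP => i; rewrite mxE.
  exact: v_def uu0 i.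
have r_gt0 : 0 < sqrtC '[u] by rewrite sqrtC_gt0.
exists ((sqrtC '[u])^-1 *: u) => [|j].
  rewrite hermitianZ normfV gtr0_norm// exprVn sqrtCK.
  by rewrite mulVf// gt_eqF.
rewrite sesquiZl (_ : '[u, x j] = 0) ?mulr0//.
move/rowP/(_ j): cM; rewrite !mxE => cMj.
rewrite [LHS]linear_sumlz -[RHS]cMj.
by apply: eq_bigr => i _; rewrite /= sesquiZl mxE.
Qed.

Lemma norm_sub_le x y t : '[x] = 1 -> '[y] = 1 ->
  `|'[t, y] - '[x, y] * '[t, x]| ^+ 2 <=
  ('[t] - `|'[t, x]| ^+ 2) * (1 - `|'[x, y]| ^+ 2).
Proof.
move=> x1 y1; rewrite sesqui_sub_proj//.
apply: le_trans (CauchySchwarz_semi _ _) _.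
by rewrite !norm_sub_proj// y1 (hermitianC x y) norm_conjC.
Qed.

(** Sufficiency of the disc condition.  With [w] the part of [t] orthogonal to
    [x] and [b = a - q * '[t, x]], the witness is
      [y = q^* *: x + (b / '[w])^* *: w + s *: u]:
    the first term gives ['[x, y] = q], the second moves ['[t, y]] by [b], and
    [s] is what is left to reach length 1; the hypotheses on [a] and [q]
    say that [s^2] is nonnegative. *)
Lemma exists_unit_with_values x t u q a :
    '[x] = 1 -> '[u] = 1 -> '[u, x] = 0 -> '[u, t] = 0 ->
    `|a - q * '[t, x]| ^+ 2 <= ('[t] - `|'[t, x]| ^+ 2) * (1 - `|q| ^+ 2) ->
    `|q| <= 1 ->
  exists y, [/\ '[y] = 1, '[x, y] = q & '[t, y] = a].
Proof.
move=> x1 u1 ux ut; set b := a - _ => b_le q_le1.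
pose w := t - '[t, x] *: x.
rewrite -norm_sub_proj// -/w in b_le.
have wx : '[w, x] = 0 by rewrite sesquiBl sesquiZl /= x1 mulr1 subrr.
have uw : '[u, w] = 0.
  by rewrite sesquiBr sesquiZr /= ux ut mulr0 subr0.
have xw : '[x, w] = 0 by rewrite hermitianC wx conjC0.
have wu : '[w, u] = 0 by rewrite hermitianC uw conjC0.
have xu : '[x, u] = 0 by rewrite hermitianC ux conjC0.
have tE : t = '[t, x] *: x + w by rewrite addrC subrK.
clearbody w.
(* If ['[w] = 0] then [b_le] forces [b = 0]. *)
have bw : b / '[w] * '[w] = b.
  have [w0|?] := eqVneq '[w] 0; last by rewrite divfK.
  apply/esym/eqP; rewrite w0 mulr0 -normr_eq0 -sqrf_eq0 eq_le exprn_ge0// andbT.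
  by rewrite (le_trans b_le)// w0 mul0r.
have d_ge0 : 0 <= 1 - `|q| ^+ 2 - `|b / '[w]| ^+ 2 * '[w].
  rewrite subr_ge0; have [w0|w_neq0] := eqVneq '[w] 0.
    by rewrite w0 mulr0 subr_ge0 expr_le1.
  have w_gt0 : 0 < '[w] by rewrite lt0r w_neq0 B_ge0.
  rewrite -(ler_pM2l w_gt0) normrM normfV exprMn exprVn (gtr0_norm w_gt0).
  by rewrite [X in X <= _](_ : _ = `|b| ^+ 2)//; field.
set d := 1 - _ - _ in d_ge0.
have sqrt_d_ge0 : 0 <= sqrtC d by rewrite sqrtC_ge0.
exists (q^* *: x + ((b / '[w])^* *: w + sqrtC d *: u)); split.
- rewrite hnormDd; last first.
    by rewrite sesquiZl sesquiDr !sesquiZr xw xu !mulr0 addr0 mulr0.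
  rewrite hnormDd; last by rewrite sesquiZl sesquiZr wu !mulr0.
  rewrite !hermitianZ !norm_conjC x1 u1 !mulr1 (ger0_norm sqrt_d_ge0) sqrtCK.
  by rewrite /d; ring.
- by rewrite !sesquiDr !sesquiZr /= xw xu x1 conjCK; ring.
- rewrite [in LHS]tE sesquiDl !sesquiZl !sesquiDr !sesquiZr /=.
  rewrite xw xu wx wu x1 !conjCK bw.
  by rewrite /b; ring.
Qed.

End SemiInnerProduct.

(** * The form of a positive operator *)

(** Over the complex numbers positivity of [A] forces self-adjointness, so
    that [<A x, y>] is a hermitian form. *)
Lemma positive_form (R : realType) (H : normedModType R[i])
    (dot : {dot H for Num.conj}) (A : {linear H -> H}) :
  positive_operator dot A ->
  exists B : {hermitian H for false & Num.conj},
    forall x y, B x y = dotA dot A x y.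
Proof.
move=> A_ge0.
pose f x y := dot (A x) y.
have f_lin : bilinear_for *%R (Num.conj \; *%R) f.
  by split=> [y|x] k u v; rewrite /f ?linearP ?linearPl ?linearPr.
pose fb := @bilinear_isBilinear.Build _ _ _ _ _ _ f f_lin.
pose F : {bilinear H -> H -> R[i] | *%R & (Num.conj \; *%R)} := HB.pack f fb.
have f_herm x y : f x y = (-1) ^+ false * (f y x)^*.
  by rewrite mul1r; exact: (psd_hermitian (f := F)).
pose fh := @isHermitianSesquilinear.Build _ _ _ _ f f_herm.
pose B : {hermitian H for false & Num.conj} := HB.pack f fb fh.
by exists B.
Qed.

(** An isotropic vector [z] of the form is orthogonal to [A z] in particular,
    so [<A z, A z> = 0] and [A z = 0]; hence the form is definite on the span
    of any vectors with independent images under [A]. *)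
Lemma exists_unit_orthogonal_of_rank (R : realType) (H : normedModType R[i])
    (dot : {dot H for Num.conj}) (A : {linear H -> H})
    (B : {hermitian H for false & Num.conj}) m n (x : 'I_m -> H) :
  positive_operator dot A -> (forall u v, B u v = dotA dot A u v) ->
  (m < n)%N -> dim_ge (range A) n ->
  exists2 u, B u u = 1 & forall j, B u (x j) = 0.
Proof.
move=> A_ge0 BE lt_mn [v [v_range v_indep]].
have B_ge0 u : 0 <= B u u by rewrite BE; exact: A_ge0.
have /choice[w Aw] : forall i, exists w, A w = v i.
  by move=> i; have [w _ <-] := v_range i; exists w.
apply: (@exists_unit_orthogonal _ _ B B_ge0 _ _ x w lt_mn) => c cw0.
apply: v_indep.
transitivity (A (\sum_i c i *: w i)).
  by rewrite linear_sum; apply: eq_bigr => i _; rewrite linearZ /= Aw.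
set z := \sum_i _ in cw0 *; apply/eqP/negPn/negP.
move=> /(neq0_dnorm_gt0 (s := dot)).
have := isotropic_orthogonal B_ge0 (A z) cw0.
by rewrite BE /dotA => ->; rewrite ltxx.
Qed.

Theorem theorem2p2 (R : realType) (H : completeNormedModType R[i])
  (dot : {dot H for Num.conj})
  (norm_dot : forall x : H, `|x| ^+ 2 = dot x x)
  (H_separable : separable_space H)
  (H_infdim : infinite_dimensional H)
  (A : {linear H -> H})
  (A_bounded : bounded_operator A)
  (A_positive : positive_operator dot A)
  (A_rank : dim_ge (range A) 3)
  (T : {linear H -> H})
  (T_A_bounded : A_bounded_operators dot A T)
  (q : R[i])
  (q_disc : `|q| <= 1) :
  q_numerical_range dot A q T =
  \bigcup_(x in [set x : H | normA dot A x = 1]) disc_G dot A q T x.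
Proof.
have [B BE] := positive_form A_positive.
have B_ge0 x : 0 <= B x x by rewrite BE; exact: A_positive.
have normA_sq x : normA dot A x ^+ 2 = B x x by rewrite sqrtCK BE.
have normA1 x : normA dot A x = 1 <-> B x x = 1.
  rewrite -normA_sq; split=> [->|/eqP]; first exact: expr1n.
  by rewrite sqrp_eq1 ?sqrtC_ge0; [move/eqP | exact: A_positive].
have discE x a : B x x = 1 -> disc_G dot A q T x a <->
    `|a - q * B (T x) x| ^+ 2 <=
    (B (T x) (T x) - `|B (T x) x| ^+ 2) * (1 - `|q| ^+ 2).
  move=> x1; rewrite /disc_G /alpha /= normA_sq -BE.
  have p_ge0 : 0 <= B (T x) (T x) - `|B (T x) x| ^+ 2.
    by rewrite -norm_sub_proj.
  have q_ge0 : 0 <= 1 - `|q| ^+ 2 by rewrite subr_ge0 expr_le1.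
  rewrite -[X in _ ^+ 2 <= X]sqrtCK sqrtCM//.
  by rewrite ler_sqr// nnegrE ?mulr_ge0 ?sqrtC_ge0.
apply/seteqP; split=> [a [x [y []]]|a [x]] /=.
  move=> /normA1 x1 /normA1 y1; rewrite -!BE => xyq ->.
  exists x; first exact/normA1.
  by apply/discE => //; rewrite -xyq; exact: norm_sub_le.
move=> /normA1 x1 /(discE _ _ x1) a_in.
have [u u1 ux] := exists_unit_orthogonal_of_rank
  (fun j : 'I_2 => if j == 0 then x else T x)
  A_positive BE (erefl : (2 < 3)%N) A_rank.
have := exists_unit_with_values B_ge0 x1 u1 (ux 0) (ux 1) a_in q_disc.
move=> [y [y1 xy Txy]]; exists x, y; split; [exact/normA1|exact/normA1| |].
- by rewrite -xy BE.
- by rewrite -Txy BE.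
Qed.
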